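(* Let $I=[-1,1]$. There is a constant $C<\infty$ such that every bounded, measurable function $f:I\to\mathbb{R}$ is the weak-$\ast$ limit in $L^\infty(I,dx)$ of a sequence of real polynomials $\{p_n\}$, each having only real zeros, with $\sup_n\|p_n\|_I\le C\|f\|_\infty$. This statement fails for $C=1$: that is, it is not true that every bounded measurable $f:I\to\mathbb{R}$ is the weak-$\ast$ limit of a sequence of real polynomials $p_n$ with only real zeros satisfying $\sup_n\|p_n\|_I\le\|f\|_\infty$.
   Context: $\|p\|_I=\sup_{x\in I}|p(x)|$, and $\|f\|_\infty$ is the $L^\infty(I)$ norm. A sequence $p_n$ converges weak-$\ast$ to $f$ in $L^\infty(I,dx)$ if $\int_I p_n g\,dx\to\int_I f g\,dx$ for every Lebesgue integrable function $g$ on $I$. ''Only real zeros'' means that every complex zero of the polynomial is real; the identically zero polynomial is counted as having only real zeros. *)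

(* Defs.v *)
From mathcomp Require Import all_boot all_order all_algebra.
From mathcomp Require Import all_classical all_reals all_analysis.
From mathcomp Require Import complex.

Set Implicit Arguments.
Unset Strict Implicit.
Unset Printing Implicit Defensive.

Import Order.TTheory GRing.Theory Num.Theory.
Import numFieldNormedType.Exports.

Local Open Scope classical_set_scope.
Local Open Scope ring_scope.

(* The real line with the sigma-algebra of Lebesgue measurable sets: the
   canonical sigma-algebra on [R] is only the Borel one.  The carrier is
   convertible to [R]. *)
Notation lebesgueType R :=
  (caratheodory_type (@wlength R idfun)^*%mu).

Definition segI {R : realType} : set R := `[(-1)%R, 1%R].

(* Functions on [segI] are encoded as total functions on the line; every notion
   below depends only on their values on [segI]. *)

Definition lebesgue_measurable_on_I (R : realType) (f : R -> R) : Prop :=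
  @measurable_fun _ _ (lebesgueType R) R segI f.

Definition lebesgue_integrable_on_I (R : realType) (g : R -> R) : Prop :=
  (@completed_lebesgue_measure R).-integrable segI (EFin \o g).

(* The essential supremum of the extension of [|f|] by zero outside [segI] is
   that of [|f|] over [segI], since [|f|] is nonnegative. *)
Definition Linfty_norm (R : realType) (f : R -> R) : \bar R :=
  Lnorm (@completed_lebesgue_measure R) +oo%E (EFin \o (f \_ segI)).

(* Valued in [\bar R], so that the supremum over [n] of an unbounded sequence
   of norms is [+oo] (the supremum on [R] would default to 0). *)
Definition sup_norm (R : realType) (p : {poly R}) : \bar R :=
  ereal_sup [set `|p.[x]|%:E | x in segI].

Definition integral_I (R : realType) (h : R -> R) : R :=
  \int[@completed_lebesgue_measure R]_(x in segI) h x.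

Definition weak_star_cvg (R : realType) (u : nat -> R -> R) (f : R -> R) :
    Prop :=
  forall g : R -> R, lebesgue_integrable_on_I g ->
    integral_I (fun x => u n x * g x) @[n --> \oo] -->
      integral_I (fun x => f x * g x).

Definition only_real_zeros (R : realType) (p : {poly R}) : Prop :=
  p = 0 \/
  forall z : R[i], root (map_poly (real_complex R) p) z ->
    exists x : R, z = x%:C%C.

Definition bounded_on_I (R : realType) (f : R -> R) : Prop :=
  [bounded f x | x in segI].

(* Main.v *)
Require Import Defs.
From mathcomp Require Import all_boot all_order all_algebra.
From mathcomp Require Import all_classical all_reals all_analysis.
From mathcomp Require Import measurable_realfun ess_sup_inf.
From mathcomp Require Import complex polyrcf ring lra.

(* Positive part, with [C = 3].  Let [M] be the essential supremum of [|f|].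
   The primitive [F] of [f] is [M]-Lipschitz, so its Bernstein polynomials [Q]
   converge to it uniformly and satisfy [|Q'| <= M].  If [T_n] is the Chebyshev
   polynomial of degree [n >= deg Q'], then [2 M T_n + Q'] changes sign [n]
   times on [-1, 1], hence has only real zeros, it is bounded by [3 M], and its
   primitives are close to those of [f] because the primitives of [T_n] are
   [O(1/n)].  Convergence of the integrals over all intervals and a uniform
   bound give weak-* convergence, by Dynkin's theorem and density of simple
   functions in L^1.

   Negative part: [f] is the sign function.  If [p] is real-rooted, [|p| <= 1] on
   [[a, b]], [m] is the midpoint and [L] the half-length of an interval between
   consecutive zeros, then
   [|p (m - h) p (m + h)| <= (1 - (h / L)^2) p(m)^2], so that the mean of [|p|]
   over that interval is at most [5/6].  Hence the integral of [p f] over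
   [[-1, 1]] is at most [11/6] if [p] has a zero there, and at most [1]
   otherwise, whereas it would have to converge to [2]. *)

Set Implicit Arguments.
Unset Strict Implicit.
Unset Printing Implicit Defensive.

Import Order.TTheory GRing.Theory Num.Theory.
Import numFieldNormedType.Exports HBSimple.

Local Open Scope classical_set_scope.
Local Open Scope ring_scope.

(** * Real-rooted polynomials and Chebyshev polynomials *)

Section real_rooted.
Variable R : realType.
Implicit Types p : {poly R}.

(** Over [R[i]] the polynomial splits into linear factors whose roots are real by hypothesis. The
    factorisation is thus the image of one over [R], and the embedding of polynomials is
    injective. *)
Lemma only_real_zerosP p : p != 0 -> only_real_zeros p ->
  exists rs : seq R, p = lead_coef p *: \prod_(z <- rs) ('X - z%:P).
Proof.
move=> p0 [p00|hp]; first by rewrite p00 eqxx in p0.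
have [r Dr] := closed_field_poly_normal (map_poly (real_complex R) p).
have lc0 : lead_coef (map_poly (real_complex R) p) != 0.
  by rewrite lead_coef_eq0 map_poly_eq0.
have rr z : z \in r -> z = (complex.Re z)%:C%C.
  move=> zr; have [|x ->//] := hp z.
  by rewrite Dr rootZ ?lc0 // root_prod_XsubC.
exists (map (@complex.Re R) r); apply: (map_poly_inj (real_complex R)).
rewrite map_polyZ rmorph_prod /= {1}Dr lead_coef_map big_map.
congr (_ *: _); rewrite big_seq [RHS]big_seq; apply: eq_bigr => z /rr {1}->.
by rewrite map_polyXsubC.
Qed.

(** With as many distinct real roots as its degree allows, [p] splits over [R], so its image over
    [R[i]] has no other roots. *)
Lemma only_real_zeros_of_roots p (rs : seq R) :
  p != 0 -> (size p <= (size rs).+1)%N -> uniq rs -> all (root p) rs ->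
  only_real_zeros p.
Proof.
move=> p0 sp urs ars.
have sz : size p = (size rs).+1.
  by apply/eqP; rewrite eqn_leq sp; exact: max_poly_roots.
right=> z; rewrite (all_roots_prod_XsubC sz ars) ?uniq_rootsE // map_polyZ.
rewrite rootZ ?fmorph_eq0 ?lead_coef_eq0// rmorph_prod /=.
rewrite rootE horner_prod prodf_seq_eq0 => /hasP[x _ /=].
rewrite map_polyXsubC hornerXsubC subr_eq0 => /eqP ->.
by exists x.
Qed.

(** The bound of the roots by [y n] is the induction invariant: the next root lies strictly between
    [y n] and [y n.+1], hence is new. *)
Lemma sign_changes_roots p (y : nat -> R) n :
  (forall k, (k < n)%N -> y k < y k.+1) ->
  (forall k, (k < n)%N -> p.[y k] * p.[y k.+1] < 0) ->
  exists rs : seq R, [/\ size rs = n, uniq rs, all (root p) rs &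
    all (fun x => x < y n) rs].
Proof.
elim: n => [|n IH] hy hp; first by exists [::].
have [k kn|k kn|rs [srs urs ars lrs]] := IH.
- exact/hy/(ltn_trans kn).
- exact/hp/(ltn_trans kn).
have [x] := poly_ivtoo (ltW (hy n (leqnn _))) (hp n (leqnn _)).
rewrite in_itv /= => /andP[nx xn] rx.
exists (x :: rs); split => /=.
- by rewrite srs.
- rewrite urs andbT; apply/negP => /(allP lrs) /= xlt.
  by have := lt_trans nx xlt; rewrite ltxx.
- by rewrite rx.
- rewrite xn /=; apply: sub_all lrs => z /= zy.
  exact: lt_trans zy (hy n (leqnn _)).
Qed.

End real_rooted.

(** * Chebyshev polynomials of the first and second kind *)

Section chebyshev.
Variable R : realType.

Fixpoint chebyshev (n : nat) : {poly R} :=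
  match n with
  | 0 => 1
  | m.+1 => match m with 0 => 'X | k.+1 => 'X * chebyshev m *+ 2 - chebyshev k end
  end.

(** Chebyshev polynomials of the second kind, which enter through the derivatives of those of the
    first kind. *)
Fixpoint chebyshevU (n : nat) : {poly R} :=
  match n with
  | 0 => 1
  | m.+1 => match m with
            | 0 => 'X *+ 2
            | k.+1 => 'X * chebyshevU m *+ 2 - chebyshevU k
            end
  end.

Lemma chebyshevSS n :
  chebyshev n.+2 = 'X * chebyshev n.+1 *+ 2 - chebyshev n.
Proof. by []. Qed.

Lemma chebyshevUSS n :
  chebyshevU n.+2 = 'X * chebyshevU n.+1 *+ 2 - chebyshevU n.
Proof. by []. Qed.

Lemma nat_ind2 (P : nat -> Prop) : P 0%N -> P 1%N ->
  (forall n, P n -> P n.+1 -> P n.+2) -> forall n, P n.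
Proof.
move=> P0 P1 PS n; suff: P n /\ P n.+1 by case.
by elim: n => // n [Pn PSn]; split => //; exact: PS.
Qed.

Lemma size_chebyshev n : (size (chebyshev n) <= n.+1)%N.
Proof.
elim/nat_ind2: n => [||n IH0 IH1]; rewrite ?size_poly1 ?size_polyX //.
rewrite chebyshevSS (leq_trans (size_polyD _ _)) // geq_max size_polyN.
have -> : (size (chebyshev n) <= n.+3)%N by exact/leqW/leqW.
rewrite andbT -scaler_nat.
rewrite (leq_trans (size_scale_leq _ _)) // (leq_trans (size_polyMleq _ _)) //.
by rewrite size_polyX.
Qed.

Lemma chebyshev_cos n (t : R) : (chebyshev n).[cos t] = cos (n%:R * t).
Proof.
elim/nat_ind2: n => [||n IH0 IH1].
- by rewrite hornerE mul0r cos0.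
- by rewrite hornerE mul1r.
rewrite chebyshevSS hornerD hornerN hornerMn hornerM hornerX IH0 IH1.
have -> : n.+2%:R * t = n.+1%:R * t + t by rewrite -[n.+2]addn1 natrD; ring.
have -> : n%:R * t = n.+1%:R * t - t by rewrite -[n.+1]addn1 natrD; ring.
by move: (_ * t) => u; rewrite cosB cosD; ring.
Qed.

Lemma chebyshev_le1 n (x : R) : -1 <= x <= 1 -> `|(chebyshev n).[x]| <= 1.
Proof.
by move=> x1; rewrite -[x]acosK ?in_itv// chebyshev_cos cos_max.
Qed.

Lemma cos_natpi n : cos (n%:R * pi) = (-1) ^+ n :> R.
Proof.
elim: n => [|n IH]; first by rewrite mul0r cos0.
by rewrite -[n.+1]addn1 natrD mulrDl mul1r cosDpi IH addn1 exprS mulN1r.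
Qed.

Lemma chebyshev_chebyshevU n :
  chebyshev n.+2 *+ 2 = chebyshevU n.+2 - chebyshevU n.
Proof.
elim/nat_ind2: n => [||n IH0 IH1].
- by rewrite /=; ring.
- by rewrite /=; ring.
rewrite chebyshevSS (chebyshevUSS n.+2).
transitivity ('X * (chebyshev n.+3 *+ 2) *+ 2 - chebyshev n.+2 *+ 2).
  by move: (chebyshev n.+2) (chebyshev n.+3) => u v; ring.
rewrite IH0 IH1 (chebyshevUSS n).
by move: (chebyshevU n) (chebyshevU n.+1) (chebyshevU n.+3) => u v w; ring.
Qed.

Lemma deriv_chebyshev n : (chebyshev n.+1)^`() = chebyshevU n *+ n.+1.
Proof.
elim/nat_ind2: n => [||n IH0 IH1].
- by rewrite /= derivX.
- by rewrite /= derivB derivMn derivM !derivX derivC; ring.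
rewrite chebyshevSS derivB derivMn derivM derivX IH0 IH1 mul1r.
rewrite mulrnDl chebyshev_chebyshevU (chebyshevUSS n).
move: (chebyshevU n) (chebyshevU n.+1) => u v.
by rewrite !mulrSr; ring.
Qed.

(** Since [T_(k+1)' = (k+1) U_k] and [2 T_(n+2) = U_(n+2) - U_n], an antiderivative of [T_(n+2)] is
    [(T_(n+3)/(n+3) - T_(n+1)/(n+1)) / 2], and both Chebyshev values are at most 1 in absolute
    value. *)
Lemma chebyshev_antideriv n : exists2 S : {poly R}, S^`() = chebyshev n.+2 &
  forall x : R, -1 <= x <= 1 -> `|S.[x]| <= n.+1%:R^-1.
Proof.
exists (2^-1 *: (n.+3%:R^-1 *: chebyshev n.+3 - n.+1%:R^-1 *: chebyshev n.+1)).
  rewrite derivZ derivB !derivZ (deriv_chebyshev n.+2) (deriv_chebyshev n).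
  move: (chebyshev_chebyshevU n).
  move: (chebyshev n.+2) (chebyshevU n.+2) (chebyshevU n) => t u v tuv.
  rewrite -(scaler_nat n.+3 u) -(scaler_nat n.+1 v) !scalerA.
  rewrite !mulVf ?pnatr_eq0 // !scale1r -tuv -(scaler_nat 2 t).
  by rewrite scalerA mulVf ?pnatr_eq0 // scale1r.
move=> x x1; have := chebyshev_le1 n.+3 x1; have := chebyshev_le1 n.+1 x1.
move: (chebyshev n.+3) (chebyshev n.+1) => u v h1 h3; rewrite !hornerE.
have i3 : n.+3%:R^-1 <= n.+1%:R^-1 :> R
  by rewrite lef_pV2 ?posrE ?ltr0n // ler_nat -addn2 leq_addr.
rewrite normrM (@ger0_norm _ 2^-1) ?invr_ge0 ?ler0n //.
have i0 : 0 <= n.+3%:R^-1 :> R by [].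
have i1 : 0 <= n.+1%:R^-1 :> R by [].
have := ler_normB (n.+3%:R^-1 * u.[x]) (n.+1%:R^-1 * v.[x]).
rewrite !normrM (ger0_norm i0) (ger0_norm i1).
have u1 : n.+3%:R^-1 * `|u.[x]| <= n.+1%:R^-1 by rewrite (le_trans _ i3) ?ler_piMr.
have v1 : n.+1%:R^-1 * `|v.[x]| <= n.+1%:R^-1 by rewrite ler_piMr.
move=> /le_trans /(_ (lerD u1 v1)).
by move: (n.+1%:R^-1) (Num.norm _) => c N; lra.
Qed.

(* [chebyshev n] equioscillates at the [n.+1] points [cos (k pi / n)], so a
   perturbation which is smaller than its amplitude keeps all the [n] sign
   changes. *)
Lemma chebyshev_perturb_real_rooted n (M : R) (q : {poly R}) :
  (size q <= n.+2)%N -> (forall x : R, -1 <= x <= 1 -> `|q.[x]| < M) ->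
  only_real_zeros (M *: chebyshev n.+1 + q).
Proof.
move=> sq hq; set p := _ + q.
(* The angles decrease with [k], so that the nodes [y k] increase. *)
pose t k : R := (n.+1 - k)%:R / n.+1%:R * pi.
pose y k := cos (t k).
have pi0 : 0 < pi :> R := pi_gt0 R.
have tin k : t k \in `[0, pi].
  rewrite in_itv /= /t mulr_ge0 ?(ltW pi0) ?mulr_ge0 ?invr_ge0 //=.
  rewrite ler_piMl ?(ltW pi0) // ler_pdivrMr ?ltr0n // mul1r ler_nat.
  by rewrite leq_subr.
have Ty k : (k <= n.+1)%N -> (chebyshev n.+1).[y k] = (-1) ^+ (n.+1 - k).
  move=> kn; rewrite chebyshev_cos -cos_natpi; congr cos.
  by rewrite /t; field; rewrite addrC natr1 pnatr_eq0.
have y1 k : -1 <= y k <= 1 by rewrite cos_geN1 cos_le1.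
have M0 : 0 < M by apply: le_lt_trans (hq _ (y1 0%N)).
have py k : p.[y k] = M * (chebyshev n.+1).[y k] + q.[y k] by rewrite !hornerE.
have hpy k : (k < n.+1)%N -> p.[y k] * p.[y k.+1] < 0.
  move=> kn; rewrite !py !Ty ?(ltnW kn) // subnS.
  have -> : (n.+1 - k = (n.+1 - k).-1.+1)%N by rewrite prednK // subn_gt0.
  set m := (n.+1 - k).-1; rewrite /= exprS.
  have := hq _ (y1 k); have := hq _ (y1 k.+1); rewrite !ltr_norml.
  rewrite -signr_odd; case: (odd m); rewrite ?expr1 ?expr0; nra.
have [|//|rs [srs urs ars _]] := @sign_changes_roots R p y n.+1.
  move=> k kn; rewrite /y ltr_cos ?tin // /t ltr_pM2r // ltr_pM2r ?invr_gt0 ?ltr0n//.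
  by rewrite ltr_nat ltn_sub2l.
apply: (@only_real_zeros_of_roots R p rs) => //.
- apply/eqP => p0; have := hpy 0%N isT.
  by rewrite p0 !hornerE ltxx.
- rewrite srs /p (leq_trans (size_polyD _ _)) // geq_max sq andbT.
  by rewrite (leq_trans (size_scale_leq _ _)) // size_chebyshev.
Qed.

End chebyshev.

(** * Real-rooted polynomials bounded by 1 *)

Section polynomial_bounds.
Variable R : realType.
Implicit Types (p P Q : {poly R}) (rs : seq R) (a b h m L : R).

(** Both [Q + P] and [Q - P] have a nonnegative derivative on the interval, so both are
    nondecreasing there. *)
Lemma norm_increment_le P Q a b : a <= b ->
  (forall x, x \in `[a, b] -> `|P^`().[x]| <= Q^`().[x]) ->
  `|P.[b] - P.[a]| <= Q.[b] - Q.[a].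
Proof.
rewrite le_eqVlt => /predU1P[<-|ab] PQ; first by rewrite !subrr normr0.
have mono (S : {poly R}) : (forall x, x \in `[a, b] -> 0 <= S^`().[x]) ->
    S.[a] <= S.[b].
  move=> S0; rewrite -subr_ge0; have [c cab ->] := poly_mvt S ab.
  by rewrite mulr_ge0 ?subr_ge0 ?(ltW ab) // S0 // (subset_itvW _ _ _ _ cab).
have /mono : forall x, x \in `[a, b] -> 0 <= (Q + P)^`().[x].
  by move=> x /PQ; rewrite derivD hornerD ler_norml; lra.
have /mono : forall x, x \in `[a, b] -> 0 <= (Q - P)^`().[x].
  by move=> x /PQ; rewrite derivB hornerD hornerN ler_norml; lra.
rewrite !hornerD !hornerN ler_norml => h1 h2.
by apply/andP; split; lra.
Qed.

Lemma norm_increment_le1 P a b : a <= b ->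
  (forall x, x \in `[a, b] -> `|P^`().[x]| <= 1) ->
  `|P.[b] - P.[a]| <= b - a.
Proof.
move=> ab P1; have := @norm_increment_le P 'X a b ab.
by rewrite derivX !hornerX; apply=> x xab; rewrite hornerC; exact: P1.
Qed.

(** Factor by factor, [(m - h - z) (m + h - z) = (m - z)^2 - h^2] lies between 0 and [(m - z)^2]. *)
Lemma gap_prod_le rs m h : 0 <= h ->
  (forall z, z \in rs -> h <= `|m - z|) ->
  `|\prod_(z <- rs) (m - h - z) * \prod_(z <- rs) (m + h - z)|
    <= (\prod_(z <- rs) (m - z)) ^+ 2.
Proof.
move=> h0; elim: rs => [|z rs IH] hrs.
  by rewrite !big_nil mulr1 normr1 expr1n.
rewrite !big_cons exprMn mulrACA normrM ler_pM //; last first.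
  by apply: IH => w wrs; apply: hrs; rewrite inE wrs orbT.
have : h <= `|m - z| by apply: hrs; rewrite mem_head.
move=> hz; have -> : (m - h - z) * (m + h - z) = (m - z) ^+ 2 - h ^+ 2 by ring.
rewrite -(@real_normK _ (m - z)) ?num_real //.
by rewrite ger0_norm ?subr_ge0 ?lerXn2r ?nnegrE // gerBl sqr_ge0.
Qed.

(* Log-concavity of [|p|] on an interval without zeros; the zero at distance
   [L] from [m] makes it quantitative. *)
Lemma gap_pair_le p rs m h L :
  p = lead_coef p *: \prod_(z <- rs) ('X - z%:P) ->
  0 < L -> 0 <= h <= L ->
  (forall z, z \in rs -> L <= `|m - z|) ->
  (exists2 z, z \in rs & `|m - z| = L) ->
  `|p.[m - h] * p.[m + h]| <= (1 - (h / L) ^+ 2) * p.[m] ^+ 2.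
Proof.
move=> -> L0 /andP[h0 hL] rsL [z zrs mz].
(* One root at distance [L] is split off: its pair of factors gives
   [L^2 - h^2 = (1 - (h / L)^2) L^2] up to sign-free constants, and [gap_prod_le] handles the other
   roots. *)
have hp x : (lead_coef p *: \prod_(z <- rs) ('X - z%:P)).[x] =
    lead_coef p * ((x - z) * \prod_(w <- rem z rs) (x - w)).
  rewrite hornerZ horner_prod (big_rem z) //= hornerXsubC.
  by under eq_bigr do rewrite hornerXsubC.
rewrite !hp.
have := @gap_prod_le (rem z rs) m h h0.
move: (\prod_(w <- _) _) (\prod_(w <- _) _) (\prod_(w <- _) _) => w v u huv.
have {huv} : `|u * v| <= w ^+ 2.
  by apply: huv => y /mem_rem /rsL; exact: le_trans.
move=> huv.
have -> : lead_coef p * ((m - h - z) * u) * (lead_coef p * ((m + h - z) * v)) =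
  (lead_coef p ^+ 2 * ((m - z) ^+ 2 - h ^+ 2)) * (u * v) by ring.
have mz2 : (m - z) ^+ 2 = L ^+ 2 by rewrite -mz real_normK ?num_real.
have hL2 : 0 <= L ^+ 2 - h ^+ 2 by rewrite subr_ge0 lerXn2r ?nnegrE ?(ltW L0).
have pL0 := mulr_ge0 (sqr_ge0 (lead_coef p)) hL2.
rewrite normrM mz2 (ger0_norm pL0).
have -> : (1 - (h / L) ^+ 2) * (lead_coef p * ((m - z) * w)) ^+ 2 =
   lead_coef p ^+ 2 * (L ^+ 2 - h ^+ 2) * w ^+ 2.
  by rewrite 3!exprMn mz2; field; rewrite gt_eqF.
exact: ler_wpM2l.
Qed.

(** Numbers [v], [w] in [[0, 1]] satisfy [v + w <= 1 + v w]. With [gap_pair_le] and [|p(m)| <= 1]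
    this gives [|p(m - h)| + |p(m + h)| <= 2 - (h / L)^2], and integration over [h] in [[0, L]]
    yields [2 L - L / 3], which is [5/6] of the length [2 L]. *)
Lemma gap_increment_le p P a b : p != 0 -> only_real_zeros p -> P^`() = p ->
  a < b -> (forall x, x \in `[a, b] -> `|p.[x]| <= 1) ->
  (forall x, x \in `]a, b[ -> ~~ root p x) -> root p a || root p b ->
  `|P.[b] - P.[a]| <= 5 / 6 * (b - a).
Proof.
move=> p0 rrp Pp ab p1 noroot abroot.
have [rs prs] := only_real_zerosP p0 rrp.
have rootE x : root p x = (x \in rs).
  by rewrite prs rootZ ?lead_coef_eq0 // root_prod_XsubC.
pose m := (a + b) / 2; pose L := (b - a) / 2.
have L0 : 0 < L by rewrite divr_gt0 ?subr_gt0.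
have rsL z : z \in rs -> L <= `|m - z|.
  rewrite -rootE => rz; rewrite leNgt; apply: contraL rz => zL; apply: noroot.
  by move: zL; rewrite ltr_norml in_itv /= /m /L; lra.
have rsL' : exists2 z, z \in rs & `|m - z| = L.
  case/orP: abroot; rewrite rootE => ?; [exists a|exists b] => //.
    by rewrite (_ : m - a = L) ?gtr0_norm // /m /L; field.
  by rewrite (_ : m - b = - L) ?normrN ?gtr0_norm // /m /L; field.
have mab h : 0 <= h <= L -> m - h \in `[a, b] /\ m + h \in `[a, b].
  by rewrite !in_itv /= /m /L; lra.
(* [D] has derivative [p(m + h) + p(m - h)] in [h] and total increment [P(b) - P(a)]; [E] is a
   primitive of [2 - (h / L)^2]. *)
pose D := (P \Po ('X + m%:P)) - (P \Po (m%:P - 'X)).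
pose E : {poly R} := 2 *: 'X - (3 * L ^+ 2)^-1 *: 'X^3.
have DE : `|D.[L] - D.[0]| <= E.[L] - E.[0].
  apply: norm_increment_le => [|h]; first exact: ltW.
  rewrite in_itv /= => /andP[h0 hL].
  have hh : 0 <= h <= L by rewrite h0.
  have := gap_pair_le prs L0 hh rsL rsL'; have [/p1 + /p1] := mab _ hh.
  have /p1 : m \in `[a, b] by rewrite in_itv /= /m; lra.
  have -> : D^`().[h] = p.[m + h] + p.[m - h].
    rewrite /D derivB !deriv_comp Pp derivB derivD !derivX !derivC addr0 sub0r.
    rewrite mulr1 mulrN1 opprK hornerD !horner_comp !hornerD hornerN hornerX.
    by rewrite hornerC (addrC h).
  have -> : E^`().[h] = 2 - (h / L) ^+ 2.
    rewrite /E derivB !derivZ derivX derivXn !hornerD hornerN !hornerZ.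
    rewrite hornerMn hornerXn hornerC; field; rewrite gt_eqF //.
  have : 0 <= (h / L) ^+ 2 <= 1.
    rewrite sqr_ge0 expr_le1 //; last exact: divr_ge0 h0 (ltW L0).
    by rewrite ler_pdivrMr // mul1r.
  move: ((h / L) ^+ 2) p.[m] p.[m - h] p.[m + h] => c u v w c1 u1 v1 w1 vw.
  have {vw} : `|v| * `|w| <= 1 - c.
    rewrite -normrM; apply: le_trans vw _.
    have : u ^+ 2 <= 1 by rewrite -real_normK ?num_real // expr_le1.
    nra.
  have := ler_normD w v.
  nra.
have DP : D.[L] - D.[0] = P.[b] - P.[a].
  rewrite /D !hornerD !hornerN !horner_comp !hornerD !hornerN !hornerX !hornerC.
  rewrite subr0 add0r subrr subr0.
  by congr (P.[_] - P.[_]); rewrite /m /L; field.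
have EL : E.[L] - E.[0] = 2 * L - L / 3.
  rewrite /E !hornerD !hornerN !hornerZ !hornerXn !hornerX expr0n /=.
  by field; rewrite gt_eqF.
move: DE; rewrite DP EL => /le_trans; apply.
rewrite /L; lra.
Qed.

(** Induction on the number of zeros inside the interval: cutting at an interior zero leaves two
    pieces that each have a zero at an endpoint, and the bound is additive in the length. *)
Lemma root_increment_le p P a b : p != 0 -> only_real_zeros p -> P^`() = p ->
  a <= b -> (forall x, x \in `[a, b] -> `|p.[x]| <= 1) ->
  root p a || root p b -> `|P.[b] - P.[a]| <= 5 / 6 * (b - a).
Proof.
move=> p0 rrp Pp; have [rs prs] := only_real_zerosP p0 rrp.
have rootE x : root p x = (x \in rs).
  by rewrite prs rootZ ?lead_coef_eq0 // root_prod_XsubC.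
have [n] := ubnP (count (fun z => z \in `]a, b[) rs).
elim: n a b => // n IH a b cn; rewrite le_eqVlt => /predU1P[<-|ab] p1 rab.
  by rewrite !subrr normr0 mulr0.
have [[c cab rc]|noroot] := pselect (exists2 c, c \in `]a, b[ & root p c); last first.
  apply: (gap_increment_le p0 rrp Pp ab p1 _ rab) => x xab.
  by apply/negP => rx; apply: noroot; exists x.
have count_lt a' b' : {subset `]a', b'[ <= `]a, b[} -> c \notin `]a', b'[ ->
    (count (fun z => z \in `]a', b'[) rs < n)%N.
  move=> sub cn'; rewrite -ltnS; apply: leq_trans cn; rewrite ltnS.
  (* Removing one occurrence of [c] from [rs] does not change the count on the smaller interval, but
     lowers the count on []a, b[] by one. *)
  have cE : (count (fun z => z \in `]a', b'[) rs =
      count (fun z => z \in `]a', b'[) (rem c rs))%N.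
    by rewrite (permP (perm_to_rem (_ : c \in rs))) -?rootE //= (negbTE cn').
  rewrite cE [leqRHS](permP (perm_to_rem (_ : c \in rs))) -?rootE //= cab.
  by rewrite add1n ltnS; apply: sub_count => z /sub.
move: cab; rewrite in_itv /= => /andP[ac cb].
have hac : `|P.[c] - P.[a]| <= 5 / 6 * (c - a).
  apply: IH (ltW ac) _ _; last by rewrite rc orbT.
    apply: count_lt; last by rewrite in_itv /= ltxx andbF.
    by move=> z; rewrite !in_itv /= => /andP[-> /lt_trans ->].
  move=> x xac; apply: p1; move: xac; rewrite !in_itv /= => /andP[-> xc].
  exact: le_trans xc (ltW cb).
have hcb : `|P.[b] - P.[c]| <= 5 / 6 * (b - c).
  apply: IH (ltW cb) _ _; last by rewrite rc.
    apply: count_lt; last by rewrite in_itv /= ltxx.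
    by move=> z; rewrite !in_itv /= => /andP[/(lt_trans ac) -> ->].
  move=> x xac; apply: p1; move: xac; rewrite !in_itv /= => /andP[xc ->].
  by rewrite (le_trans (ltW ac) xc).
have -> : P.[b] - P.[a] = (P.[b] - P.[c]) + (P.[c] - P.[a]) by ring.
rewrite (le_trans (ler_normD _ _)) //.
apply: le_trans (lerD hcb hac) _; lra.
Qed.

(** The left-hand side is the integral of [p] times the sign function. If [p] has a zero in
    [[-1, 1]], cutting at it bounds the half that contains it by [5/6], and the other half is at
    most 1. Without a zero the sign of [p] is constant and the two halves partly cancel. *)
Lemma sign_correlation_le p P : only_real_zeros p -> P^`() = p ->
  (forall x : R, -1 <= x <= 1 -> `|p.[x]| <= 1) ->
  (P.[1] - P.[0]) - (P.[0] - P.[-1]) <= 11 / 6.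
Proof.
move=> rrp Pp p1.
have inc a b : -1 <= a -> a <= b -> b <= 1 -> `|P.[b] - P.[a]| <= b - a.
  move=> a1 ab b1; apply: norm_increment_le1 => // x; rewrite Pp in_itv /=.
  by move=> /andP[ax xb]; apply: p1; rewrite (le_trans a1 ax) (le_trans xb b1).
have rinc a b : p != 0 -> -1 <= a -> a <= b -> b <= 1 -> root p a || root p b ->
    `|P.[b] - P.[a]| <= 5 / 6 * (b - a).
  move=> p0 a1 ab b1; apply: root_increment_le => // x; rewrite in_itv /=.
  by move=> /andP[ax xb]; apply: p1; rewrite (le_trans a1 ax) (le_trans xb b1).
have i10 : `|P.[0] - P.[-1]| <= 1.
  by apply: le_trans (inc _ _ _ _ _) _; rewrite ?lerN10 ?ler01 // opprK add0r.
have i01 : `|P.[1] - P.[0]| <= 1.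
  by apply: le_trans (inc _ _ _ _ _) _; rewrite ?lerN10 ?ler01 // subr0.
move: i10 i01; rewrite !ler_norml => i10 i01.
have [p0|p0] := eqVneq p 0.
  have Pc : `|P.[1] - P.[0]| <= 0.
    apply: le_trans (@norm_increment_le P 0 0 1 ler01 _) _; last first.
      by rewrite !horner0 subrr.
    by move=> x _; rewrite Pp p0 deriv0 !horner0 normr0.
  by move: Pc; rewrite ler_norml; lra.
have [[z z1 rz]|noroot] := pselect (exists2 z, -1 <= z <= 1 & root p z).
  move/andP: z1 => [zN1 z1]; have [z0|z0] := leP 0 z.
    have := rinc 0 z p0 (lerN10 R) z0 z1.
    have := rinc z 1 p0 zN1 z1 (lexx 1).
    by rewrite rz orbT !ler_norml => /(_ isT) ? /(_ isT) ?; lra.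
  have := rinc (-1) z p0 (lexx _) zN1 z1.
  have := rinc z 0 p0 zN1 (ltW z0) ler01.
  by rewrite rz orbT !ler_norml => /(_ isT) ? /(_ isT) ?; lra.
(* The two increments are the values [p(c)] and [p(d)], which have the same sign by the intermediate
   value theorem, so that their difference is at most 1. *)
have [c + Ec] := poly_mvt P (@ltr01 R).
have [d + Ed] := poly_mvt P (@ltrN10 R).
rewrite !in_itv /= => /andP[d1 d0] /andP[c0 c1].
rewrite Ec Ed Pp; have dc := ltW (lt_trans d0 c0).
have : 0 < p.[d] * p.[c].
  rewrite ltNge; apply/negP => /(polyrcf.poly_ivt dc)[z].
  rewrite in_itv /= => /andP[dz zc] rz; apply: noroot; exists z => //.
  by rewrite (le_trans (ltW d1) dz) (le_trans zc (ltW c1)).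
have := p1 c; have := p1 d; rewrite !ler_norml.
rewrite (ltW d1) (ltW c1) (le_trans (lerN10 R) (ltW c0)) (le_trans (ltW d0) ler01).
move=> /(_ isT) + /(_ isT); nra.
Qed.

End polynomial_bounds.

(** * Bernstein polynomials *)

Section bernstein.
Variable R : realType.
Implicit Types (c d : nat -> R) (t : R).

(* [\sum_k c k *: B_(n,k)], by de Casteljau's recursion. *)
Fixpoint bernstein n c : {poly R} :=
  match n with
  | 0 => (c 0%N)%:P
  | m.+1 => (1 - 'X) * bernstein m c + 'X * bernstein m (fun k => c k.+1)
  end.

Lemma bernsteinS n c t : (bernstein n.+1 c).[t] =
  (1 - t) * (bernstein n c).[t] + t * (bernstein n (fun k => c k.+1)).[t].
Proof. by rewrite /= !hornerE. Qed.

Lemma bernsteinB n c d :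
  bernstein n (fun k => c k - d k) = bernstein n c - bernstein n d.
Proof.
elim: n c d => [|n IH] c d; first by rewrite /= polyCB.
rewrite /= IH (IH (fun k => c k.+1) (fun k => d k.+1)).
move: (bernstein n c) (bernstein n d) (bernstein n _) (bernstein n _).
by move=> *; ring.
Qed.

Lemma bernstein_le n c d t : 0 <= t <= 1 -> (forall k, c k <= d k) ->
  (bernstein n c).[t] <= (bernstein n d).[t].
Proof.
move=> /andP[t0 t1]; elim: n c d => [|n IH] c d cd; first by rewrite /= !hornerC.
rewrite !bernsteinS lerD // ler_wpM2l ?subr_ge0 //; first exact: IH.
by apply: IH => k; exact: cd.
Qed.

Lemma bernsteinN n c : bernstein n (fun k => - c k) = - bernstein n c.
Proof.
have bern0 : bernstein n (fun=> 0) = 0.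
  by elim: n => [|n /= ->] //; rewrite !mulr0 addr0.
rewrite -[RHS]add0r -bern0 -bernsteinB.
by congr bernstein; apply/funext => k; rewrite sub0r.
Qed.

Lemma bernstein_norm_le n c d t : 0 <= t <= 1 -> (forall k, `|c k| <= d k) ->
  `|(bernstein n c).[t]| <= (bernstein n d).[t].
Proof.
move=> t01 cd; rewrite ler_norml -hornerN -bernsteinN; apply/andP.
by split; apply: bernstein_le => // k; have := cd k; rewrite ler_norml => /andP[].
Qed.

(** Differentiating the recursion produces the difference of the two polynomials it combines, which
    [bernsteinB] identifies with the polynomial of the forward differences. *)
Lemma deriv_bernstein n c :
  (bernstein n.+1 c)^`() = bernstein n (fun k => c k.+1 - c k) *+ n.+1.
Proof.
elim: n c => [|n IH] c.
  rewrite /= derivD !derivM derivB !derivX !derivC polyCB.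
  by move: (c 0%N)%:P (c 1%N)%:P => u v; ring.
have := bernsteinB n.+1 (fun k => c k.+1) c.
have : bernstein n.+1 (fun k => c k.+1 - c k) = (1 - 'X) *
  bernstein n (fun k => c k.+1 - c k) +
  'X * bernstein n (fun k => c k.+2 - c k.+1) by [].
rewrite [bernstein n.+2 c]/(_ * bernstein n.+1 c + _ * bernstein n.+1 _).
rewrite derivD !derivM derivB !derivX derivC !IH.
move: (bernstein n.+1 _) (bernstein n.+1 _) (bernstein n.+1 _) => u v w.
move: (bernstein n _) (bernstein n _) => y z.
rewrite !mulrSr -/(1 - 'X : {poly R}) => ew wv.
have -> : v = w + u by rewrite wv subrK.
by rewrite ew; ring.
Qed.

(** The Bernstein weights are the binomial law, with mean [n t] and variance [n t (1 - t)]. The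
    shift [a] is general because the recursion replaces it by [1 + a]; the case [r = 0] says that
    constants are reproduced. *)
Lemma bernstein_moment2 n (a e r : R) t :
  (bernstein n (fun k => e + r * (k%:R + a) ^+ 2)).[t] =
  e + r * ((n%:R * t + a) ^+ 2 + n%:R * t * (1 - t)).
Proof.
elim: n a => [|n IH] a; first by rewrite /= hornerC; ring.
rewrite bernsteinS IH.
have -> : (fun k => e + r * (k.+1%:R + a) ^+ 2) =
          (fun k => e + r * (k%:R + (1 + a)) ^+ 2).
  by apply/funext => k; rewrite -natr1 addrA.
by rewrite IH -natr1; ring.
Qed.

(** [Q] is the Bernstein polynomial of degree [N = (m + 1)^2] of [F], moved from [[-1, 1]] to
    [[0, 1]] by [l]. Neighbouring coefficients differ by at most [2 M / N], so
    [|Q'| <= N (2 M / N) / 2 = M]. The binomial spread is of order [1 / (m + 1)], which gives the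
    error bound. *)
Lemma lipschitz_poly_approx (F : R -> R) (M : R) m : 0 <= M ->
  (forall x y, `|F x - F y| <= M * `|x - y|) ->
  exists Q : {poly R},
    (forall x : R, -1 <= x <= 1 -> `|Q^`().[x]| <= M) /\
    (forall x : R, -1 <= x <= 1 -> `|Q.[x] - F x| <= 2 * M * m.+1%:R^-1).
Proof.
move=> M0 FM; pose N := (m.+1 ^ 2)%N.
have N0 : 0 < N%:R :> R by rewrite ltr0n expn_gt0.
have m0 : 0 < m.+1%:R :> R by rewrite ltr0n.
have NE : N%:R = m.+1%:R ^+ 2 :> R by rewrite natrX.
pose c k := F (2 * (k%:R / N%:R) - 1).
pose l : {poly R} := 2^-1 *: ('X + 1).
exists (bernstein N c \Po l).
have lE x : l.[x] = (x + 1) / 2 by rewrite /l hornerZ !hornerE mulrC.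
have l01 x : -1 <= x <= 1 -> 0 <= l.[x] <= 1.
  by rewrite lE => /andP[xN1 x1]; apply/andP; split; lra.
split=> x /l01 lx.
  rewrite deriv_comp hornerM horner_comp.
  have -> : l^`().[x] = 2^-1.
    by rewrite /l derivZ derivD derivX derivC hornerZ hornerD !hornerC; ring.
  have NS : N = N.-1.+1 by rewrite prednK // expn_gt0.
  rewrite {1}NS deriv_bernstein hornerMn normrM normrMn -NS.
  have cM k : `|c k.+1 - c k| <= 2 * M / N%:R.
    apply: le_trans (FM _ _) _.
    have -> : 2 * (k.+1%:R / N%:R) - 1 - (2 * (k%:R / N%:R) - 1) = 2 / N%:R :> R.
      by rewrite -natr1; field; rewrite gt_eqF.
    by rewrite ger0_norm ?divr_ge0 // mulrA (mulrC M).
  have := bernstein_norm_le N.-1 lx cM.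
  have -> : (fun=> 2 * M / N%:R) =
      (fun k => 2 * M / N%:R + 0 * (k%:R + 0) ^+ 2) :> (nat -> R).
    by apply/funext => k; rewrite mul0r addr0.
  rewrite bernstein_moment2 mul0r addr0 => h.
  rewrite -(mulr_natl _ N) normfV normr_nat.
  rewrite [leRHS](_ : M = N%:R * (2 * M / N%:R) * 2^-1); last first.
    by field; rewrite gt_eqF.
  by rewrite ler_pM2r ?invr_gt0 ?ltr0n // ler_pM2l.
rewrite horner_comp; set t := l.[x].
have -> : F x = F (2 * t - 1) by congr F; rewrite /t lE; field.
(* A quadratic majorant of [2 M |k / N - t|], chosen because the second moment formula evaluates its
   Bernstein polynomial. *)
pose d k : R := M * m.+1%:R^-1 +
  M * m.+1%:R / N%:R ^+ 2 * (k%:R + - (N%:R * t)) ^+ 2.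
have cd k : `|c k - F (2 * t - 1)| <= d k.
  apply: le_trans (FM _ _) _.
  have -> : 2 * (k%:R / N%:R) - 1 - (2 * t - 1) = 2 * ((k%:R - N%:R * t) / N%:R).
    by field; rewrite gt_eqF.
  rewrite normrM ger0_norm // /d; set u := (_ / _).
  have -> : M * m.+1%:R / N%:R ^+ 2 * (k%:R + - (N%:R * t)) ^+ 2 =
      M * (m.+1%:R * u ^+ 2) by rewrite /u; field; rewrite gt_eqF.
  rewrite -mulrDr ler_wpM2l //.
  (* AM-GM *)
  have := sqr_ge0 (m.+1%:R * `|u| - 1).
  have -> : (m.+1%:R * `|u| - 1) ^+ 2 = m.+1%:R *
      (m.+1%:R^-1 + m.+1%:R * u ^+ 2 - 2 * `|u|).
    rewrite -(@real_normK _ u) ?num_real //; field.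
    by rewrite addrC natr1 gt_eqF.
  by rewrite pmulr_rge0 // subr_ge0.
have FE : (bernstein N (fun=> F (2 * t - 1))).[t] = F (2 * t - 1).
  have -> : (fun=> F (2 * t - 1)) =
      (fun k => F (2 * t - 1) + 0 * (k%:R + 0) ^+ 2) :> (nat -> R).
    by apply/funext => k; rewrite mul0r addr0.
  by rewrite bernstein_moment2 mul0r addr0.
rewrite -FE -hornerN -hornerD -bernsteinB.
apply: le_trans (bernstein_norm_le N lx cd) _.
rewrite bernstein_moment2 subrr expr0n add0r.
have -> : M * m.+1%:R / N%:R ^+ 2 * (N%:R * t * (1 - t)) =
    M * m.+1%:R^-1 * (t * (1 - t)).
  rewrite NE; field; rewrite addrC natr1 gt_eqF //.
have My : 0 <= M * m.+1%:R^-1 by rewrite mulr_ge0 ?invr_ge0.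
have -> : 2 * M * m.+1%:R^-1 = M * m.+1%:R^-1 * 2 by ring.
move: lx => /andP[t0 t1].
move: (M * m.+1%:R^-1) My => y y0.
have t2 : t * (1 - t) <= 1 by nra.
by have := ler_wpM2l y0 t2; move: (y * (t * (1 - t))) => z; lra.
Qed.

End bernstein.

(** * Lebesgue integration on [[-1, 1]] *)

Section lebesgue_on_segI.
Variable R : realType.
Local Notation mu := (@completed_lebesgue_measure R).
Local Notation T := (lebesgueType R).
Implicit Types (A D : set T) (v : T -> R) (B t : R).

Lemma borel_lebesgue (A : set R) : measurable A -> @measurable _ T A.
Proof. by move=> mA; exact: sub_caratheodory. Qed.

Lemma measurable_segI : @measurable _ T segI.
Proof. by apply: borel_lebesgue; exact: measurable_itv. Qed.

Lemma borel_fun_lebesgue D (h : R -> R) : measurable_fun setT h ->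
  @measurable_fun _ _ T R D h.
Proof.
move=> mh mD Y mY; apply: measurableI => //; apply: borel_lebesgue.
by rewrite -[_ @^-1` _]setTI; exact: mh.
Qed.

Lemma horner_measurable D (p : {poly R}) :
  @measurable_fun _ _ T R D (horner p).
Proof.
by apply: borel_fun_lebesgue; exact: measurable_poly.
Qed.

Lemma completed_measure_segI : mu segI = 2%:E.
Proof.
have := @lebesgue_measure_itv R `[-1, 1]; rewrite /= lte_fin.
have -> : -1 < 1 :> R by rewrite (lt_trans (ltrN10 R)).
by rewrite -EFinB opprK => <-.
Qed.

Lemma measure_sub_segI D : measurable D -> D `<=` segI -> (mu D < +oo)%E.
Proof.
move=> mD DI; apply: le_lt_trans (ltry 2).
rewrite -completed_measure_segI le_measure ?inE //.
exact: measurable_segI.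
Qed.

Lemma bounded_integrable v B D : measurable_fun (segI : set T) v ->
  (forall x, segI x -> `|v x| <= B) -> measurable D -> D `<=` segI ->
  mu.-integrable D (EFin \o v).
Proof.
move=> mv vB mD DI; apply: measurable_bounded_integrable => //.
- exact: measure_sub_segI.
- exact: measurable_funS measurable_segI DI mv.
- by exists B; split; rewrite ?num_real // => y By x /DI/vB /le_trans; apply; exact: ltW.
Qed.

Section bounded.
Variables (v : T -> R) (B : R).
Hypothesis mv : measurable_fun (segI : set T) v.
Hypothesis vB : forall x, segI x -> `|v x| <= B.

Lemma norm_integral_le D : measurable D -> D `<=` segI ->
  `|\int[mu]_(x in D) v x| <= B * fine (mu D).
Proof.
move=> mD DI; have Bint : mu.-integrable D (EFin \o cst B).
  exact: (@bounded_integrable (cst B) `|B|).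
apply: le_trans (le_normr_Rintegral _ _) _ => //.
  exact: bounded_integrable mv vB mD DI.
rewrite -Rintegral_cst //; apply: le_Rintegral => //; last first.
  by move=> x /DI/vB.
by apply: (integrable_norm (bounded_integrable mv vB mD DI)).
Qed.

Lemma integral_setD D D' : measurable D -> measurable D' -> D' `<=` D ->
  D `<=` segI -> \int[mu]_(x in D `\` D') v x =
  \int[mu]_(x in D) v x - \int[mu]_(x in D') v x.
Proof.
move=> mD mD' D'D DI; have mDD' : measurable (D `\` D') by exact: measurableD.
rewrite -{2}(setDUK D'D).
rewrite Rintegral_setU //.
- by rewrite addrC addKr.
- by rewrite setDUK //; exact: bounded_integrable mv vB mD DI.
- by rewrite disj_set2E setDIK eqxx.
Qed.

End bounded.

Lemma setID_distr (X : Type) (A C E : set X) :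
  A `&` (C `\` E) = (A `&` C) `\` (A `&` E).
Proof.
apply/seteqP; split=> x /=.
  by move=> [Ix [Cx nEx]]; split => // -[_ /nEx].
by move=> [[Ix Cx] nIE]; split => //; split => // Ex; exact: nIE.
Qed.

(** * Weak convergence to 0 from boundedness and convergence on rays *)

Section weak_convergence.
Variables (v : nat -> T -> R) (B : R).
Hypothesis mv : forall n, measurable_fun (segI : set T) (v n).
Hypothesis vB : forall n x, segI x -> `|v n x| <= B.
Hypothesis v_rays : forall t,
  \int[mu]_(x in segI `&` `]-oo, t[) v n x @[n --> \oo] --> (0 : R).

Let B0 : 0 <= B.
Proof.
apply: le_trans (normr_ge0 (v 0%N 0)) (vB 0%N _).
by rewrite /segI /= in_itv /= lerN10 ler01.
Qed.

Let mI := measurable_segI.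

(** This property is propagated from rays to Borel sets, then to Lebesgue measurable sets, and by
    linearity to simple functions. *)
Let small A := \int[mu]_(x in segI `&` A) v n x @[n --> \oo] --> (0 : R).

Let mIA A : measurable A -> measurable (segI `&` A : set T).
Proof. exact: measurableI. Qed.

Let smallT : small setT.
Proof.
have E : segI `&` setT = segI `&` `]-oo, 2[ :> set R.
  apply/seteqP; split=> x; rewrite /segI /= !in_itv /=.
    by move=> [/andP[-> x1] _]; rewrite x1 (le_lt_trans x1) // ltr1n.
  by move=> [].
by rewrite /small E; exact: v_rays.
Qed.

Let smallD C E : measurable C -> measurable E -> E `<=` C ->
  small C -> small E -> small (C `\` E).
Proof.
move=> mC mE EC sC sE; rewrite /small.
rewrite setID_distr; under eq_fun => n.
  rewrite (integral_setD (mv n) (vB n) (mIA mC) (mIA mE)); [over| |].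
    by move=> x [Ix Ex]; split => //; exact: EC.
  by move=> x [].
by rewrite -[0 : R](subrr 0); exact: cvgB.
Qed.

(** The uniform bound [B] controls the integral over the remainder [A \ E] independently of [n]. *)
Let small_approx A : measurable A ->
  (forall e, 0 < e -> exists E, [/\ measurable E, E `<=` A, small E &
     B * fine (mu (segI `&` (A `\` E))) < e]) -> small A.
Proof.
move=> mA happ; apply/cvgr0Pnorm_lt => e e0.
have e2 : 0 < e / 2 by exact: divr_gt0.
have [E [mE EA sE AE]] := happ _ e2.
near=> n.
have mAE : measurable (A `\` E) by exact: measurableD.
have EAE : \int[mu]_(x in segI `&` A) v n x =
    \int[mu]_(x in segI `&` (A `\` E)) v n x + \int[mu]_(x in segI `&` E) v n x.
  rewrite setID_distr (integral_setD (mv n) (vB n) (mIA mA) (mIA mE)) ?subrK //.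
  by move=> x [Ix Ex]; split => //; exact: EA.
rewrite EAE (le_lt_trans (ler_normD _ _)) // (splitr e) ltrD //.
  by apply: le_lt_trans (norm_integral_le (mv n) (vB n) (mIA mAE) _) AE => x [].
near: n; move/cvgr0Pnorm_lt: sE; exact.
Unshelve. all: by end_near. Qed.

(** Open rays are closed under intersection and generate the Borel sets, and the small sets form a
    Dynkin class. Countable disjoint unions are reached from finite ones by [small_approx], as the
    tails have measure tending to 0. *)
Let small_borel (A : set R) : measurable A -> small A.
Proof.
have mE := RGenInftyO.measurableE R.
have GI : setI_closed (@RGenInftyO.G R).
  move=> _ _ [x ->] [y ->]; exists (Num.min x y).
  by apply/seteqP; split=> z; rewrite /= !in_itv /= lt_min => /andP.
move=> mA; have GA : (@RGenInftyO.G R).-sigma.-measurable A by rewrite -mE.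
apply: (@dynkin_induction _ (measurableTypeR R) _ small mE GI smallT) GA.
- by move=> _ [x ->]; exact: v_rays.
- move=> S /borel_lebesgue mS sS; rewrite -setTD.
  exact: (smallD measurableT mS (@subsetT _ _) smallT sS).
move=> F mF tF sF; have mFT k : @measurable _ T (F k) by exact: borel_lebesgue (mF k).
pose U N := \big[setU/set0]_(k < N) F k.
have mU N : @measurable _ T (U N) by apply: bigsetU_measurable.
have mbF : @measurable _ T (\bigcup_k F k) by exact: bigcup_measurable.
have sU N : small (U N).
  elim: N => [|N IH].
    rewrite /U big_ord0 -(setDv setT).
    exact: (smallD measurableT measurableT (@subsetT _ _) smallT smallT).
  (* A disjoint union is rewritten with nested differences, to which [smallD] applies; disjointness
     gives the required inclusion of [F N] in the complement of [U N]. *)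
  have -> : U N.+1 = setT `\` ((setT `\` U N) `\` F N).
    by rewrite /U big_ord_recr /= !setTD setDE -setCU setCK.
  have mT : @measurable _ T setT by exact: measurableT.
  have mTU : @measurable _ T (setT `\` U N) by exact: measurableD.
  have sTU := smallD mT (mU N) (@subsetT _ _) smallT IH.
  apply: (smallD mT (measurableD mTU (mFT N)) (@subsetT _ _) smallT).
  apply: (smallD mTU (mFT N) _ sTU (sF N)).
  rewrite setTD => x FNx; rewrite /U -bigcup_mkord => -[k /= kN Fkx].
  have kE : k = N by apply: tF => //; exists x.
  by rewrite kE ltnn in kN.
apply: small_approx => // e e0.
pose V N : set T := segI `&` (\bigcup_k F k `\` U N).
have mV N : measurable (V N) by apply: mIA; exact: measurableD.
have V0 : \bigcap_N V N = set0.
  apply/seteqP; split=> // x Vx; have [_ [[k _ Fkx] _]] := Vx 0%N I.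
  have [_ [_]] := Vx k.+1 I; apply.
  by rewrite /U big_ord_recr; right.
have : mu \o V @ \oo --> mu (\bigcap_N V N).
  apply: nonincreasing_cvg_mu => //.
  - by apply: measure_sub_segI => // x [].
  - by rewrite V0.
  - apply/nonincreasing_seqP => n; apply/subsetPset => x [Ix [bx nU]].
    split => //; split => // Ux; apply: nU.
    by rewrite /U big_ord_recr; left.
rewrite V0 measure0 => /fine_cvgP[_ /cvgr0Pnorm_lt cV].
(* [B] may be 0, so the tolerance is divided by [B + 1]. *)
have B1 : 0 < B + 1 by rewrite ltr_wpDl.
have [N _ /(_ N (leqnn _))] := cV _ (divr_gt0 e0 B1); rewrite /= => VN.
exists (U N); split => //.
  by move=> x; rewrite /U -bigcup_mkord => -[k _ Fk]; exists k.
move: VN; rewrite ltr_pdivlMr // => /(le_lt_trans _); apply.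
rewrite mulrC ler_pM ?ler_norm ?lerDl ?fine_ge0 //.
Qed.

(** A Lebesgue measurable set is a Borel set together with a null set, and the null part contributes
    nothing. *)
Let small_lebesgue A : measurable A -> small A.
Proof.
move=> mA; have : completed_algebra_gen (@lebesgue_measure R) A.
  by rewrite -g_sigma_completed_algebra_genE completed_caratheodory_measurable.
move=> [X mX [N [Z [mZ Z0 NZ]] XNA]].
apply: small_approx => // e e0; exists X; split.
- exact: borel_lebesgue.
- by rewrite -XNA; exact: subsetUl.
- exact: small_borel.
suff -> : mu (segI `&` (A `\` X)) = 0%E by rewrite mulr0.
apply/eqP; rewrite -measure_le0 -Z0; apply: le_outer_measure.
by move=> x [_ []]; rewrite -XNA => -[//|/NZ].
Qed.

Let integrable_mul n (g : T -> R) : mu.-integrable segI (EFin \o g) ->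
  mu.-integrable segI (EFin \o (fun x => v n x * g x)).
Proof.
move=> gint; apply: (integrableMr mI (mv n) _ gint).
exists B; split; rewrite ?num_real // => y By x /(vB n) /le_trans; apply.
exact: ltW.
Qed.

Let small_sfun (h : {sfun T >-> R}) :
  \int[mu]_(x in segI) (v n x * h x) @[n --> \oo] --> (0 : R).
Proof.
(* Integrability is carried along because additivity of the integral requires it. *)
pose Q (g : T -> R) := mu.-integrable segI (EFin \o g) /\
  \int[mu]_(x in segI) (v n x * g x) @[n --> \oo] --> (0 : R).
have Q0 : Q (fun=> 0).
  split; first exact: integrable0.
  under eq_fun do under eq_Rintegral do rewrite mulr0.
  rewrite /Rintegral; under eq_fun do rewrite integral0.
  exact: cvg_cst.
have QD g1 g2 : Q g1 -> Q g2 -> Q (fun x => g1 x + g2 x).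
  move=> [i1 c1] [i2 c2]; split.
    by have := integrableD mI i1 i2; congr integrable.
  under eq_fun => n.
    under eq_Rintegral do rewrite mulrDr.
    rewrite RintegralD //; [over|exact: integrable_mul..].
  by rewrite -[0 : R](addr0 0); exact: cvgD.
have QI y A : measurable A -> Q (fun x => y * \1_A x).
  move=> mA; split.
    have : mu.-integrable segI (fun x => y%:E * (EFin \o \1_A) x)%E.
      apply: integrableZl => //; apply: (@bounded_integrable _ 1) => //.
      by move=> x _; rewrite indicE ger0_norm // lern1; case: (_ \in _).
    by congr integrable.
  have -> : (fun n => \int[mu]_(x in segI) (v n x * (y * \1_A x))) =
            (fun n => y * \int[mu]_(x in segI `&` A) v n x).
    apply/funext => n; rewrite Rintegral_mkcondr -RintegralZl //.
      by apply: eq_Rintegral => x _; rewrite patch_indic mulrCA.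
    rewrite -restrict_EFin; apply/integrable_restrict => //.
    by apply: (bounded_integrable (mv n) (vB n) (mIA mA)) => x [].
  by rewrite -(mulr0 y); apply: cvgMr; exact: small_lebesgue.
have [s hE] : exists s : seq R,
    forall x, h x = \sum_(y <- s) (y * \1_(h @^-1` [set y]) x).
  eexists=> x; rewrite fimfunE fsbig_finite //; reflexivity.
suff [] : Q h by [].
rewrite (_ : (h : T -> R) = fun x => \sum_(y <- s) (y * \1_(h @^-1` [set y]) x)).
  elim: s {hE} => [|y s IH].
  by under eq_fun do rewrite big_nil.
  under eq_fun do rewrite big_cons.
  apply: QD => //; apply: QI.
  exact: measurable_funPTI.
by apply/funext => x; rewrite hE.
Qed.

(** Replacing [g] by a simple function [h k] close to it in L^1 changes the integrals by at most [B]
    times the L^1 distance, uniformly in [n]. *)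
Lemma bounded_weak_cvg (g : T -> R) : mu.-integrable segI (EFin \o g) ->
  \int[mu]_(x in segI) (v n x * g x) @[n --> \oo] --> (0 : R).
Proof.
move=> gint; have [h [hint _ /fine_cvgP[hfin /cvgr0Pnorm_lt hg]]] :=
  approximation_sfun_integrable mI gint.
apply/cvgr0Pnorm_lt => e e0.
have B1 : 0 < B + 1 by rewrite ltr_wpDl.
have eB : 0 < e / 2 / (B + 1) by rewrite !divr_gt0.
have e2 : 0 < e / 2 by exact: divr_gt0.
near \oo => k.
have hgk : `|fine (\int[mu]_(z in segI) `|(EFin \o g) z - (h k z)%:E|)%E| <
  e / 2 / (B + 1) by near: k; exact: hg.
have dint : mu.-integrable segI (EFin \o (fun x => g x - h k x)).
  by have := integrableB mI gint (hint k); congr integrable.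
near=> n.
have -> : \int[mu]_(x in segI) (v n x * g x) = \int[mu]_(x in segI) (v n x * h k x)
  + \int[mu]_(x in segI) (v n x * (g x - h k x)).
  rewrite -RintegralD //; [|exact: integrable_mul (hint k)|exact: integrable_mul].
  by apply: eq_Rintegral => x _; ring.
rewrite (le_lt_trans (ler_normD _ _)) // (splitr e) ltrD //.
  by near: n; move/cvgr0Pnorm_lt: (small_sfun (h k)); exact.
move: hgk; rewrite ltr_pdivlMr // => /(le_lt_trans _); apply.
apply: le_trans (le_normr_Rintegral mI (integrable_mul n dint)) _.
have aint : mu.-integrable segI (EFin \o (fun x => `|g x - h k x|)).
  exact: (integrable_norm dint).
rewrite ger0_norm ?fine_ge0 ?integral_ge0 //.
rewrite -[X in _ <= X * _]/(\int[mu]_(x in segI) `|g x - h k x|).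
apply: (@le_trans _ _ ((\int[mu]_(x in segI) `|g x - h k x|) * B)).
  rewrite -RintegralZr //; apply: le_Rintegral => //.
  - exact: (integrable_norm (integrable_mul n dint)).
  - by have := integrableZr mI B aint; congr integrable.
  - by move=> x Ix; rewrite normrM mulrC ler_wpM2l ?vB.
by rewrite ler_wpM2l ?lerDl // Rintegral_ge0.
Unshelve. all: by end_near. Qed.

End weak_convergence.
End lebesgue_on_segI.

(** * Approximation *)

Section real_rooted_primitive.
Variable R : realType.

Lemma real_rooted_primitive_approx (F : R -> R) (M : R) m : 0 <= M ->
  (forall x y, `|F x - F y| <= M * `|x - y|) ->
  exists P : {poly R}, [/\ only_real_zeros P^`(),
    forall x : R, -1 <= x <= 1 -> `|P^`().[x]| <= 3 * M &
    forall x : R, -1 <= x <= 1 ->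
      `|P.[x] - P.[-1] - (F x - F (-1))| <= 8 * M * m.+1%:R^-1].
Proof.
move=> M0 FM; have [Q [Q' QF]] := lipschitz_poly_approx m M0 FM.
have N1 : -1 <= (-1 : R) <= 1 by rewrite lexx (le_trans (lerN10 R)).
(* The perturbation [Q'] must be strictly below the amplitude [2 M], so [M = 0], where [F] is
   constant, is treated apart. *)
move: M0; rewrite le_eqVlt => /predU1P[M0|M0].
  exists 0; split; first by left; rewrite deriv0.
    by move=> x _; rewrite deriv0 horner0 normr0 -M0 mulr0.
  move=> x _; rewrite !horner0 subrr sub0r normrN.
  by apply: le_trans (FM _ _) _; rewrite -M0 mulr0 !mul0r.
(* Large enough both for [Q'] to have degree at most that of [chebyshev n.+2] and for [1 / (n + 1)]
   to be at most [1 / (m + 1)]. *)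
pose n := (size Q^`() + m)%N.
have [S ST S1] := chebyshev_antideriv R n.
exists (2 * M *: S + Q); rewrite derivD derivZ ST.
have nm : n.+1%:R^-1 <= m.+1%:R^-1 :> R.
  by rewrite lef_pV2 ?posrE ?ltr0n // ler_nat ltnS leq_addl.
split.
- apply: chebyshev_perturb_real_rooted.
    by rewrite -!addnS leq_addr.
  by move=> x /Q' /le_lt_trans; apply; rewrite ltr_pMl // ltr1n.
- move=> x x1; rewrite hornerD hornerZ (le_trans (ler_normD _ _)) //.
  have -> : 3 * M = 2 * M + M by ring.
  rewrite lerD ?Q' // normrM ger0_norm; last by rewrite mulr_ge0 // ltW.
  by rewrite ler_piMr ?chebyshev_le1 // mulr_ge0 // ltW.
move=> x x1; rewrite !hornerD !hornerZ.
have -> : 2 * M * S.[x] + Q.[x] - (2 * M * S.[-1] + Q.[-1]) - (F x - F (-1)) =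
  2 * M * (S.[x] - S.[-1]) + ((Q.[x] - F x) - (Q.[-1] - F (-1))) by ring.
have Sx := le_trans (S1 x x1) nm; have SN := le_trans (S1 _ N1) nm.
(* Half of the error comes from [2 M S] at the two endpoints, the other half from [Q - F] at the
   same points. *)
have -> : 8 * M * m.+1%:R^-1 = 2 * M * (m.+1%:R^-1 + m.+1%:R^-1) +
  (2 * M * m.+1%:R^-1 + 2 * M * m.+1%:R^-1) by ring.
rewrite (le_trans (ler_normD _ _)) // lerD //; last first.
  by rewrite (le_trans (ler_normB _ _)) // lerD ?QF.
rewrite normrM (@ger0_norm _ (2 * M)) ?mulr_ge0 ?(ltW M0) //.
rewrite ler_wpM2l ?mulr_ge0 ?(ltW M0) //.
by rewrite (le_trans (ler_normB _ _)) // lerD.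
Qed.

Lemma poly_primitive (p : {poly R}) : exists P : {poly R}, P^`() = p.
Proof.
(* The constant coefficient is a division by 0, hence 0 by convention; differentiation discards
   it. *)
exists (\poly_(i < (size p).+1) (p`_i.-1 / i%:R)); apply/polyP => i.
rewrite coef_deriv coef_poly ltnS /=; case: ltnP => ip.
  by rewrite -[_ / _ *+ _]mulr_natr divfK // pnatr_eq0.
by rewrite mul0rn nth_default.
Qed.

End real_rooted_primitive.

(** * Integrals of polynomials and of bounded functions over rays *)

Section integrals.
Variable R : realType.
Local Notation mu := (@completed_lebesgue_measure R).
Local Notation T := (lebesgueType R).

Lemma integral_poly (P : {poly R}) (a b : R) : a <= b ->
  \int[mu]_(x in `[a, b]) P^`().[x] = P.[b] - P.[a].
Proof.
(* [continuous_FTC2] is applied with Lebesgue measure on Borel sets; the completed measure is pushed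
   forward to it by the identity map. *)
have E : (\int[mu]_(x in `[a, b]) (P^`().[x])%:E =
    \int[@lebesgue_measure R]_(x in `[a, b]) (P^`().[x])%:E)%E.
  have mid : @measurable_fun _ _ T (measurableTypeR R) setT idfun.
    by apply: borel_fun_lebesgue; exact: measurable_id.
  have mab : measurable (`[a, b] : set R) by exact: measurable_itv.
  have mp : @measurable_fun _ _ (measurableTypeR R) _ setT (EFin \o horner P^`()).
    by apply/measurable_EFinP; exact: measurable_poly.
  have ip : mu.-integrable `[a, b] (EFin \o horner P^`()).
    apply: measurable_bounded_integrable.
    - exact: borel_lebesgue.
    - apply: (@le_lt_trans _ _ (@lebesgue_measure R `[a, b])); first by [].
      by rewrite lebesgue_measure_itv /=; case: ifP => _; rewrite ?ltry.
    - exact: horner_measurable.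
    - have ch : {within `[a, b], continuous (horner P^`() : R -> R^o)}.
        by apply: continuous_subspaceT => x; exact: continuous_horner.
      have /compact_bounded[K [_ hK]] := continuous_compact ch (@segment_compact R a b).
      by exists K; split; rewrite ?num_real // => ? ? ? ?; exact: hK.
  apply: etrans (esym (integral_pushforward mid mp ip mab)) _.
  exact: eq_measure_integral.
rewrite le_eqVlt => /predU1P[ab|ab]; rewrite /Rintegral E.
  by rewrite ab set_itv1 integral_set1 subrr.
rewrite (@continuous_FTC2 _ _ (horner P)) //=.
- by apply: continuous_subspaceT => x; exact: continuous_horner.
- split; first by move=> x _; exact: derivable_horner.
    by apply: cvg_at_right_filter; exact: continuous_horner.
  by apply: cvg_at_left_filter; exact: continuous_horner.
- by move=> x _; rewrite derivE.
Qed.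

Lemma norm_integral_le_ae (v : T -> R) (M : R) (D : set T) : 0 <= M ->
  measurable D -> (mu D < +oo)%E -> mu.-integrable D (EFin \o v) ->
  {ae mu, forall x, D x -> `|v x| <= M} ->
  `|\int[mu]_(x in D) v x| <= M * fine (mu D).
Proof.
move=> M0 mD Doo iv vM.
rewrite -lee_fin EFin_normr_Rintegral // EFinM fineK ?ge0_fin_numE //.
apply: le_trans (le_abse_integral mu mD (measurable_int _ iv)) _.
apply: integral_le_bound => //; first exact: measurable_int iv.
Qed.

(** Dynkin's theorem asks for open rays with any endpoint, whereas primitives give integrals over
    [[-1, s]]. Clamping [t] to [[-1, 1]] links the two, and the sets differ at most by the null set
    [{s}]. The point [s] is the same for all [v]. *)
Lemma ray_integral (t : R) : exists2 s, -1 <= s <= 1 &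
  forall (v : T -> R) (B : R), measurable_fun (segI : set T) v ->
  (forall x, segI x -> `|v x| <= B) ->
  \int[mu]_(x in segI `&` `]-oo, t[) v x = \int[mu]_(x in segI `&` `]-oo, s]) v x.
Proof.
have mI : @measurable _ T segI := @measurable_segI R.
have [t1|t1] := ltP 1 t.
  exists 1; first by rewrite lexx (le_trans (lerN10 R)).
  move=> v B _ _; congr Rintegral; apply/seteqP; split=> x; rewrite /segI /= !in_itv /=.
    by move=> [/andP[-> ->]].
  by move=> [/andP[-> x1] _]; rewrite x1 (le_lt_trans x1 t1).
exists (Num.max (-1) t).
  by rewrite le_max lexx ge_max t1 andbT (le_trans (lerN10 R) ler01).
set s := Num.max _ _ => v B mv vB.
have mS : @measurable _ T (segI `&` `]-oo, s]).
  by apply: measurableI => //; apply: borel_lebesgue; exact: measurable_itv.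
have mt : @measurable _ T (segI `&` `]-oo, t[).
  by apply: measurableI => //; apply: borel_lebesgue; exact: measurable_itv.
have sub : (segI : set T) `&` `]-oo, t[ `<=` segI `&` `]-oo, s].
  move=> x; rewrite /= !in_itv /= => -[Ix xt]; split => //.
  by rewrite le_max (ltW xt) orbT.
apply/eqP; rewrite eq_sym -subr_eq0 -(integral_setD mv vB mS mt sub); last by move=> x [].
rewrite -normr_le0.
have mSt := measurableD mS mt.
apply: le_trans (norm_integral_le mv vB mSt _) _; first by move=> x [[]].
suff -> : mu ((segI `&` `]-oo, s]) `\` (segI `&` `]-oo, t[)) = 0%E by rewrite mulr0.
apply/eqP; rewrite -measure_le0 -(lebesgue_measure_set1 s); apply: le_outer_measure.
move=> x; rewrite /segI /= !in_itv /= => -[[x1 xs] nxt].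
apply/eqP; rewrite eq_le xs /= /s ge_max; case/andP: x1 => xN1 x1.
by rewrite xN1 leNgt; apply/negP => xt; apply: nxt; rewrite xN1 x1.
Qed.

Lemma ray_integral_poly (P : {poly R}) (s : R) : -1 <= s <= 1 ->
  \int[mu]_(x in segI `&` `]-oo, s]) P^`().[x] = P.[s] - P.[-1].
Proof.
move=> /andP[sN1 s1]; rewrite -integral_poly //; congr Rintegral.
apply/seteqP; split=> x; rewrite /segI /= !in_itv /=.
  by move=> [/andP[-> _]].
by move=> /andP[-> xs]; rewrite xs (le_trans xs s1).
Qed.

(** The Lipschitz constant is the almost everywhere bound [M], so that it can be the L^oo norm; the
    pointwise bound [B] provides integrability. *)
Lemma ray_integral_lipschitz (f : T -> R) (B M : R) :
  measurable_fun (segI : set T) f -> (forall x, segI x -> `|f x| <= B) ->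
  0 <= M -> {ae mu, forall x, segI x -> `|f x| <= M} ->
  let F t := \int[mu]_(x in segI `&` `]-oo, t]) f x in
  forall s t : R, `|F t - F s| <= M * `|t - s|.
Proof.
move=> mf fB M0 fM F.
have mI : @measurable _ T segI := @measurable_segI R.
have mray t : @measurable _ T (segI `&` `]-oo, t]).
  by apply: measurableI => //; apply: borel_lebesgue; exact: measurable_itv.
suff main s t : s <= t -> `|F t - F s| <= M * `|t - s|.
  by move=> s t; have [/main //|/ltW/main] := leP s t; rewrite distrC (distrC s).
move=> st.
have sub : (segI : set T) `&` `]-oo, s] `<=` segI `&` `]-oo, t].
  by move=> x; rewrite /= !in_itv /= => -[Ix xs]; split => //; exact: le_trans st.
rewrite -(integral_setD mf fB (mray t) (mray s) sub); last by move=> x [].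
have mD := measurableD (mray t) (mray s).
set D := (_ `\` _) in mD *.
have DI : D `<=` segI by move=> x [[]].
apply: (@le_trans _ _ (M * fine (mu D))).
  apply: norm_integral_le_ae => //.
  - exact: measure_sub_segI.
  - exact: bounded_integrable mf fB mD DI.
  - by apply: (@filterS _ _ (ae_filter_ringOfSetsType mu) _ _ _ fM) => x + /DI; exact.
rewrite ler_wpM2l // ger0_norm ?subr_ge0 // -lee_fin fineK; last first.
  by rewrite ge0_fin_numE //; exact: measure_sub_segI.
have -> : (t - s)%:E = @lebesgue_measure R `]s, t].
  rewrite lebesgue_measure_itv /= lte_fin; case: ltP => //= ts.
  by rewrite (_ : t = s) ?subrr //; apply/le_anti; rewrite ts st.
apply: le_outer_measure => x [[Ix]]; rewrite /= !in_itv /= => xt nxs.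
by rewrite xt andbT ltNge; apply/negP => xs; apply: nxs.
Qed.

End integrals.

(** * The L^oo norm and the two halves of the theorem *)

Section main.
Variable R : realType.
Local Notation mu := (@completed_lebesgue_measure R).
Local Notation T := (lebesgueType R).

(** [Lnorm] at infinity is the essential supremum when the whole space has positive measure, which
    holds as it contains [segI]. *)
Lemma Linfty_normE (f : R -> R) :
  Linfty_norm f = ess_sup mu (fun x => `|(f \_ segI) x|%:E).
Proof.
rewrite /Linfty_norm Lnorm.unlock ifT //.
apply: (@lt_le_trans _ _ (mu segI)); first by rewrite completed_measure_segI lte_fin.
by apply: le_outer_measure.
Qed.

Lemma Linfty_norm_le (f : R -> R) (K : R) : 0 <= K ->
  (forall x, segI x -> `|f x| <= K) -> (Linfty_norm f <= K%:E)%E.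
Proof.
move=> K0 fK; rewrite Linfty_normE; apply/ess_supP; apply: aeW => x.
by rewrite lee_fin patchE; case: ifPn => [/set_mem/fK|_]; rewrite ?normr0.
Qed.

Lemma Linfty_norm_ge (f : R -> R) :
  {ae mu, forall x, segI x -> (`|f x|%:E <= Linfty_norm f)%E}.
Proof.
rewrite Linfty_normE.
have := @ess_sup_ge _ _ _ mu (fun x => `|(f \_ segI) x|%:E).
apply: (@filterS _ _ (ae_filter_ringOfSetsType mu)) => x.
by move=> /= + Ix; rewrite patchE mem_set.
Qed.

Lemma Linfty_norm_bounded (f : R -> R) (K : R) :
  (forall x, segI x -> `|f x| <= K) -> exists2 M : R, 0 <= M &
  Linfty_norm f = M%:E /\ {ae mu, forall x, segI x -> `|f x| <= M}.
Proof.
move=> fK; have K0 : 0 <= K.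
  apply: le_trans (normr_ge0 (f 0)) (fK 0 _).
  by rewrite /segI /= in_itv /= lerN10 ler01.
have N0 : (0 <= Linfty_norm f)%E by exact: Lnorm_ge0.
have Nfin : Linfty_norm f \is a fin_num.
  rewrite ge0_fin_numE //; apply: le_lt_trans (Linfty_norm_le K0 fK) (ltry _).
exists (fine (Linfty_norm f)); first exact: fine_ge0.
split; first by rewrite fineK.
apply: (@filterS _ _ (ae_filter_ringOfSetsType mu) _ _ _ (Linfty_norm_ge f)).
by move=> x + Ix => /(_ Ix); rewrite -lee_fin fineK.
Qed.

Lemma real_rooted_weak_approx (f : R -> R) :
  bounded_on_I f -> lebesgue_measurable_on_I f ->
  exists p : nat -> {poly R},
    [/\ forall n, only_real_zeros (p n),
        weak_star_cvg (fun n x => (p n).[x]) f &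
        (ereal_sup [set sup_norm (p n) | n in [set: nat]]
          <= 3%:E * Linfty_norm f)%E].
Proof.
move=> bf mf; have [K [_ /(_ (K + 1))]] := bf.
rewrite ltrDl => /(_ ltr01) fK.
have [M M0 [NM fM]] := Linfty_norm_bounded fK.
have K0 : 0 <= K + 1.
  apply: le_trans (normr_ge0 (f 0)) (fK 0 _).
  by rewrite /segI /= in_itv /= lerN10 ler01.
pose F t := \int[mu]_(x in segI `&` `]-oo, t]) f x.
have FM := ray_integral_lipschitz mf fK M0 fM.
have [P hP] : exists P : nat -> {poly R}, forall m, [/\ only_real_zeros (P m)^`(),
    forall x : R, -1 <= x <= 1 -> `|(P m)^`().[x]| <= 3 * M &
    forall x : R, -1 <= x <= 1 ->
      `|(P m).[x] - (P m).[-1] - (F x - F (-1))| <= 8 * M * m.+1%:R^-1].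
  exists (fun m => sval (cid (real_rooted_primitive_approx m M0 (fun x y => FM y x)))).
  by move=> m; case: cid.
(* The domain of integration is the single point -1. *)
have F1 : F (-1) = 0.
  have mS : @measurable _ T (segI `&` `]-oo, -1]).
    by apply: measurableI; apply: borel_lebesgue; exact: measurable_itv.
  apply/normr0_eq0/le_anti; rewrite normr_ge0 andbT.
  apply: le_trans (norm_integral_le mf fK mS _) _; first by move=> x [].
  suff -> : mu (segI `&` `]-oo, -1]) = 0%E by rewrite mulr0.
  apply/eqP; rewrite -measure_le0 -(@lebesgue_measure_set1 R (-1)).
  apply: le_outer_measure => x; rewrite /segI /= !in_itv /=.
  by move=> [/andP[x1 _] x2]; apply/le_anti; rewrite x1 x2.
have segP (x : R) : segI x -> -1 <= x <= 1 by rewrite /segI /= in_itv.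
exists (fun n => (P n)^`()); split.
- by move=> n; have [] := hP n.
- have mp n : @measurable_fun _ _ T R segI (horner (P n)^`()).
    exact: horner_measurable.
  pose v n (x : T) := (P n)^`().[x] - f x.
  have mv n : measurable_fun (segI : set T) (v n) by exact: measurable_funB.
  have pM n x : segI x -> `|(P n)^`().[x]| <= 3 * M.
    by move=> /segP; have [_ + _] := hP n; exact.
  have vB n x : segI x -> `|v n x| <= 3 * M + (K + 1).
    by move=> Ix; rewrite (le_trans (ler_normB _ _)) // lerD ?pM ?fK.
  have mI : @measurable _ T segI := @measurable_segI R.
  (* Over [[-1, s]] the integral of [v n] is the error of the primitive of the polynomial at [s], at
     most [8 M / (n + 1)]. *)
  have vrays t : \int[mu]_(x in segI `&` `]-oo, t[) v n x @[n --> \oo] --> (0 : R).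
    have [s s1 hs] := ray_integral t.
    have mS : @measurable _ T (segI `&` `]-oo, s]).
      by apply: measurableI => //; apply: borel_lebesgue; exact: measurable_itv.
    have SI : (segI : set T) `&` `]-oo, s] `<=` segI by move=> x [].
    apply/cvgr0Pnorm_le => e e0.
    have : (8 * M) * m.+1%:R^-1 @[m --> \oo] --> (8 * M * 0 : R).
      by apply: cvgMr; exact: cvg_harmonic.
    rewrite mulr0 => /cvgr0Pnorm_le /(_ e e0); apply: filterS => m.
    apply: le_trans; rewrite (hs _ _ (mv m) (vB m)) RintegralB //; last 2 first.
    + exact: bounded_integrable (mp m) (pM m) mS SI.
    + exact: bounded_integrable mf fK mS SI.
    rewrite ray_integral_poly // -/(F s) -[F s]subr0 -F1.
    have [_ _ /(_ s s1) /le_trans] := hP m; apply.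
    exact: ler_norm.
  move=> g gint.
  have bI (h : T -> R) (C : R) : measurable_fun (segI : set T) h -> (forall x, segI x -> `|h x| <= C) ->
      mu.-integrable segI (EFin \o (fun x => h x * g x)).
    move=> mh hC; apply: (integrableMr mI mh _ gint).
    exists C; split; rewrite ?num_real // => y Cy x /hC /le_trans; apply.
    exact: ltW.
  have := bounded_weak_cvg mv vB vrays gint.
  have -> : (fun n => \int[mu]_(x in segI) (v n x * g x)) =
      (fun n => integral_I (fun x => (P n)^`().[x] * g x) - integral_I (fun x => f x * g x)).
    apply/funext => n; rewrite /integral_I -RintegralB //.
    + by apply: eq_Rintegral => x _; rewrite mulrBl.
    + exact: bI (mp n) (pM n).
    + exact: bI mf fK.
  by move/cvg_sub0; apply; exact: cvg_cst.
- rewrite NM -EFinM; apply: ge_ereal_sup => _ [n _ <-].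
  apply: ge_ereal_sup => _ [x /segP x1 <-]; rewrite lee_fin.
  by have [_ + _] := hP n; exact.
Qed.

(** The value at 0 is 1, so that the absolute value and the square are 1 everywhere. *)
Definition sign_step (x : R) : R := if x < 0 then -1 else 1.

Lemma norm_sign_step (x : R) : `|sign_step x| = 1.
Proof. by rewrite /sign_step; case: ifP => _; rewrite ?normrN normr1. Qed.

Lemma sign_stepE (x : R) : sign_step x = 2 * \1_(`[0, +oo[%classic : set R) x - 1.
Proof.
rewrite /sign_step indicE; case: ltP => x0.
  by rewrite memNset ?mulr0 ?sub0r //= in_itv /= andbT; apply/negP; rewrite -ltNge.
by rewrite mem_set ?mulr1 //= ?in_itv /= ?x0 //; ring.
Qed.

Lemma measurable_sign_step : lebesgue_measurable_on_I sign_step.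
Proof.
rewrite /lebesgue_measurable_on_I.
rewrite (_ : sign_step = fun x => 2 * \1_(`[0, +oo[%classic : set R) x - 1).
  have mA : @measurable _ T (`[0, +oo[%classic : set R).
    by apply: borel_lebesgue; exact: measurable_itv.
  apply: measurable_funB; last exact: measurable_cst.
  apply: measurable_funM; first exact: measurable_cst.
  exact: (@measurable_indic _ T R segI _ mA).
by apply/funext => x; rewrite sign_stepE.
Qed.

(** The weak limit is tested against [sign_step] itself: the integrals would have to tend to 2,
    while [sign_correlation_le] keeps them at most [11/6]. *)
Lemma sign_step_not_real_rooted_limit (p : nat -> {poly R}) :
  (forall n, only_real_zeros (p n)) ->
  weak_star_cvg (fun n x => (p n).[x]) sign_step ->
  ~ (ereal_sup [set sup_norm (p n) | n in [set: nat]] <= 1%:E)%E.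
Proof.
move=> rrp pf psup.
have p1 n (x : R) : -1 <= x <= 1 -> `|(p n).[x]| <= 1.
  move=> x1; rewrite -lee_fin; apply: le_trans psup.
  apply: le_trans (ereal_sup_ubound _); last by exists n.
  by apply: ereal_sup_ubound; exists x => //; rewrite /segI /= in_itv.
have mI : @measurable _ T segI := @measurable_segI R.
pose A : set R := `[0, +oo[%classic.
have mA : @measurable _ T A by apply: borel_lebesgue; exact: measurable_itv.
have fint : lebesgue_integrable_on_I sign_step.
  apply: (bounded_integrable measurable_sign_step _ mI (@subset_refl _ segI)).
  by move=> x _; rewrite norm_sign_step.
have IAE : segI `&` A = `[0, 1]%classic :> set R.
  apply/seteqP; split=> x; rewrite /segI /A /= !in_itv /= andbT.
    by move=> [/andP[_ ->] ->].
  by move=> /andP[x0 ->]; rewrite x0 (le_trans (lerN10 R) x0).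
have : integral_I (fun x => sign_step x * sign_step x) = 2.
  rewrite /integral_I (@eq_Rintegral _ _ _ _ _ (cst 1)); last first.
    by move=> x _; rewrite /sign_step; case: ifP => _; rewrite ?mulrNN mulr1.
  rewrite Rintegral_cst // mul1r.
  exact: (congr1 fine (completed_measure_segI R)).
(* The tolerance is the gap [2 - 11/6 = 1/6]. *)
move=> ff2; have := pf sign_step fint; rewrite ff2 => /cvgrPdist_lt /(_ 6^-1).
have e0 : 0 < 6^-1 :> R by rewrite invr_gt0.
move=> /(_ e0) [n _ /(_ n (leqnn _))] /=; rewrite ltr_norml => /andP[_].
have [P PE] := poly_primitive (p n).
have mp : @measurable_fun _ _ T R segI (horner (p n)) by exact: horner_measurable.
have pB (x : R) : segI x -> `|(p n).[x]| <= 1.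
  by rewrite /segI /= in_itv => x1; exact: p1.
have pint := bounded_integrable mp pB mI (@subset_refl _ segI).
(* The sign function is twice the indicator of [A] minus 1, and [A] meets [segI] in [[0, 1]]. *)
have -> : integral_I (fun x => (p n).[x] * sign_step x) =
    2 * (P.[1] - P.[0]) - (P.[1] - P.[-1]).
  rewrite -(integral_poly P ler01) -(integral_poly P (le_trans (lerN10 R) ler01)).
  rewrite PE -IAE Rintegral_mkcondr.
  have pAint : mu.-integrable segI (EFin \o (horner (p n) \_ A)).
    rewrite -restrict_EFin; apply/integrable_restrict => //.
    by apply: (integrableS mI _ _ pint) => //; exact: measurableI.
  rewrite -RintegralZl // -RintegralB //; last first.
    by have := integrableZl mI 2 pAint; congr integrable.
  apply: eq_Rintegral => x _; rewrite sign_stepE patch_indic /=.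
  by ring.
have := sign_correlation_le (rrp n) PE (@p1 n).
lra.
Qed.

End main.

Local Open Scope ereal_scope.

Theorem theorem1p2 (R : realType) :
  (exists C : R, forall f : R -> R,
      bounded_on_I f -> lebesgue_measurable_on_I f ->
      exists p : nat -> {poly R},
        [/\ forall n, only_real_zeros (p n),
            weak_star_cvg (fun n x => (p n).[x]%R) f &
            ereal_sup [set sup_norm (p n) | n in [set: nat]]
              <= C%:E * Linfty_norm f]) /\
  ~ (forall f : R -> R,
      bounded_on_I f -> lebesgue_measurable_on_I f ->
      exists p : nat -> {poly R},
        [/\ forall n, only_real_zeros (p n),
            weak_star_cvg (fun n x => (p n).[x]%R) f &
            ereal_sup [set sup_norm (p n) | n in [set: nat]]
              <= Linfty_norm f]).
Proof.
split; first by exists 3%R => f; exact: real_rooted_weak_approx.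
have bI : bounded_on_I (@sign_step R).
  exists 1%R; split; first exact: num_real.
  by move=> y y1 x _ /=; rewrite norm_sign_step ltW.
move=> /(_ _ bI (@measurable_sign_step R)) [p [rrp pf psup]].
apply: (sign_step_not_real_rooted_limit rrp pf (le_trans psup _)).
by apply: Linfty_norm_le => // x _; rewrite norm_sign_step.
Qed.
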